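(* Let $E$ be a $C^*$-embedded subspace of the Sorgenfrey plane $\mathbb{S}^2$. Then $E$, regarded as a subspace of $\mathbb{R}^2$ with its Euclidean topology, is a hereditarily Baire space.
   Context: The Sorgenfrey line $\mathbb{S}$ is the set of real numbers with the topology generated by the half-open intervals $[a,b)$; the Sorgenfrey plane $\mathbb{S}^2$ is $\mathbb{S}\times\mathbb{S}$ with the product topology. The spaces $\mathbb{S}^2$ and $\mathbb{R}^2$ (Euclidean topology) have the same underlying set. A subspace $E$ of a topological space $X$ is $C^*$-embedded in $X$ if every bounded continuous function $f:E\to\mathbb{R}$ extends to a continuous function on $X$; here $E$ carries the topology inherited from $X=\mathbb{S}^2$. A topological space is hereditarily Baire if every closed subspace of it is a Baire space. *)

(* Defs.v *)
From HB Require Import structures.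
From mathcomp Require Import all_boot all_order all_algebra.
From mathcomp Require Import all_classical all_reals topology.
From mathcomp Require Import normedtype.

Set Implicit Arguments.
Unset Strict Implicit.
Unset Printing Implicit Defensive.

Import Order.TTheory GRing.Theory Num.Theory.
Import numFieldNormedType.Exports.

Local Open Scope classical_set_scope.
Local Open Scope ring_scope.

(* A copy of R, so that the half-open topology does not clash with the
   canonical Euclidean topology of R. *)
Definition sorgenfrey (R : realType) : Type := R.
Arguments sorgenfrey : simpl never.

Section Sorgenfrey.
Variable R : realType.

Definition sorgenfrey_base (p : R * R) : set (sorgenfrey R) :=
  [set x : R | p.1 <= x < p.2].

Lemma sorgenfrey_base_cover : \bigcup_(p in setT) sorgenfrey_base p = setT.
Proof.
apply/seteqP; split => // x _; exists ((x : R), (x : R) + 1) => //.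
by rewrite /sorgenfrey_base /= lexx ltrDl ltr01.
Qed.

Lemma sorgenfrey_base_join (p q : R * R) (t : sorgenfrey R) :
  setT p -> setT q -> sorgenfrey_base p t -> sorgenfrey_base q t ->
  exists k, [/\ setT k, sorgenfrey_base k t &
    sorgenfrey_base k `<=` sorgenfrey_base p `&` sorgenfrey_base q].
Proof.
move=> _ _ /andP[p1t tp2] /andP[q1t tq2].
exists (Num.max p.1 q.1, Num.min p.2 q.2); split => //.
  by rewrite /sorgenfrey_base /= ge_max lt_min p1t q1t tp2 tq2.
move=> x; rewrite /sorgenfrey_base /= ge_max lt_min.
by move=> /andP[/andP[-> ->] /andP[-> ->]].
Qed.

HB.instance Definition _ := Choice.copy (sorgenfrey R) R.
HB.instance Definition _ := isBaseTopological.Build (sorgenfrey R)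
  sorgenfrey_base_cover sorgenfrey_base_join.

End Sorgenfrey.

Notation sorgenfrey_plane R := (sorgenfrey R * sorgenfrey R)%type.

(* E used as a type is [set_type E], with the induced topology. *)
Definition Cstar_embedded (R : realType) (X : topologicalType) (E : set X) :=
  forall f : E -> R, continuous f -> bounded_fun f ->
    exists g : X -> R, continuous g /\ forall x : E, g (set_val x) = f x.

Definition Baire_space (T : topologicalType) :=
  forall F : nat -> set T, (forall i, open (F i) /\ dense (F i)) ->
    dense (\bigcap_i F i).

Definition hereditarily_Baire (T : topologicalType) :=
  forall A : set T, closed A -> Baire_space A.

(* Main.v *)
Require Import Defs.
From HB Require Import structures.
From mathcomp Require Import all_boot all_order all_algebra.
From mathcomp Require Import all_classical all_reals topology normedtype.
From mathcomp Require Import interval_inference lra.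
Import numFieldNormedType.Exports.

Set Implicit Arguments.
Unset Strict Implicit.
Unset Printing Implicit Defensive.

Import Order.TTheory GRing.Theory Num.Theory.

Local Open Scope classical_set_scope.
Local Open Scope ring_scope.

(** Suppose that E, with its Euclidean topology, is not hereditarily Baire.

    A Hausdorff pseudometric space which is not Baire contains a countable,
    closed set without isolated points, in the spirit of Hurewicz's theorem
    (crowded_closed_sequence).  Applied to a closed subspace of E, this gives a
    sequence x of distinct points of E whose range F is Euclidean-closed in E
    and crowded, together with a splitting of F into two parts, each of which
    accumulates at every point of F.

    C*-embeddedness enters through one construction (extend_colouring): every
    two-colouring of F that is locally constant in the Sorgenfrey topology is
    the restriction of a continuous function on the Sorgenfrey plane.  Since F
    is Euclidean-closed in E, small half-open boxes around the points of F form
    a family that is locally finite off F, so the colouring spreads to a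
    clopen partition of E.  Two consequences contradict each other.

    First, F is closed in the Sorgenfrey plane (sorgenfrey_closed): if F
    accumulated at p from the upper right, colouring alternate rings around p
    would give a function with no continuous extension to p.  Hence each point
    of the Euclidean closure of F is in F or is the corner of a half-open box
    missing F.  The Baire category theorem in the closure of F makes the size
    of these boxes uniform on a dense subset of a piece of F.  On that piece no
    point of F lies strictly to the upper right of another and no three are on
    one horizontal or vertical line, so the piece is discrete in the Sorgenfrey
    topology (locally_discrete).

    Second, being discrete, the piece can be coloured by the two dense parts,
    and the colouring extends to a Sorgenfrey-continuous g.  A second category
    argument yields a place where g is below 2/3, or above 1/3, on boxes of
    uniform size with dense corners; such a box meets the box on which g is
    near 1, or near 0, at a nearby point of F of the other colour
    (no_continuous_dense_splitting). *)

(** * Choosing sequences and small radii *)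

(** Recursion in which the next term may depend on all earlier ones: P h z says
    that z is an admissible continuation of the finite history h. *)
Lemma history_choice (X : eqType) (good : X -> Prop) (P : seq X -> X -> Prop) :
  (forall h, (forall w, w \in h -> good w) -> exists z, good z /\ P h z) ->
  exists f : nat -> X, forall n, good (f n) /\ P (mkseq f n) (f n).
Proof.
move=> step.
have [s sP] : {s : seq X -> X & forall h, (forall w, w \in h -> good w) ->
    good (s h) /\ P h (s h)}.
  apply: (@choice _ _ (fun h z => (forall w, w \in h -> good w) ->
    good z /\ P h z)) => h.
  have [gh|ngh] := pselect (forall w, w \in h -> good w).
    by have [z zP] := step h gh; exists z.
  by have [z _] := step [::] (fun _ => ltac:(by [])); exists z.
pose hist n := iter n (fun h => rcons h (s h)) [::].
pose f n := s (hist n).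
have histE n : hist n = mkseq f n.
  by elim: n => // n IH; rewrite mkseqS -IH.
have gf n : good (f n).
  have [m] := ubnP n; elim: m n => // m IH n nm.
  apply: (sP (hist n) _).1 => w; rewrite histE => /mapP[i].
  by rewrite mem_iota => /andP[_ ni] ->; apply: IH; apply: leq_trans ni _.
exists f => n; split => //; rewrite -histE; apply: (sP (hist n) _).2.
by move=> w; rewrite histE => /mapP[i _ ->].
Qed.

Lemma finite_lower_bound (R : realType) (u : nat -> R) (M : nat) :
  (forall i, (i < M)%N -> 0 < u i) ->
  exists2 d, 0 < d & forall i, (i < M)%N -> d <= u i.
Proof.
elim: M => [|M IH] u0; first by exists 1.
have [i iM|d d0 dP] := IH; first by apply: u0; apply: ltnW.
exists (Num.min d (u M)); first by rewrite lt_min d0 u0.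
move=> i; rewrite ltnS leq_eqVlt => /orP[/eqP->|iM].
  by rewrite ge_min lexx orbT.
by rewrite ge_min dP.
Qed.

Lemma invS_lt (R : realType) (e : R) : 0 < e ->
  exists m, forall n, (m <= n)%N -> n.+1%:R^-1 < e.
Proof.
move=> e0; have [m _ mP] := near_infty_natSinv_lt (PosNum e0).
by exists m => n /mP.
Qed.

(** The exponents of 2 and 3 in n encode a parent index and a colour; every
    pair of them has arbitrarily large codes, and the parent logn 2 n of a
    positive n is smaller than n. *)
Lemma infinitely_many_codes (p M : nat) (b : bool) :
  exists n, [/\ (M < n)%N, logn 2 n = p & odd (logn 3 n) = b].
Proof.
exists (2 ^ p * (3 ^ b * 5 ^ M))%N; split.
- apply: leq_trans (ltn_expl M (isT : 1 < 5)%N) _.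
  by rewrite mulnA leq_pmull // muln_gt0 !expn_gt0.
- by rewrite !lognM ?muln_gt0 ?expn_gt0 // !lognX !logn_prime //= !muln0 muln1 !addn0.
- by rewrite !lognM ?muln_gt0 ?expn_gt0 // !lognX !logn_prime //= !muln0 muln1 addn0; case: b.
Qed.

Lemma ball_avoiding_point (R : realType) (T : pseudoMetricType R) (p q : T) :
  hausdorff_space T -> q <> p -> exists2 d, 0 < d & ~ ball p d q.
Proof.
move=> hT qp.
have /nbhs_ballP[d /= d0 dP] : nbhs p (~` [set q]).
  apply: open_nbhs_nbhs; split; last by move=> /= pq; apply: qp.
  apply: closed_openC.
  exact: (accessible_closed_set1 (hausdorff_accessible hT)).
by exists d => // /dP; apply.
Qed.

(** * Closed crowded sequences in spaces that are not Baire *)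

Section NonBaire.
Variables (R : realType) (T : pseudoMetricType R).
Hypothesis hT : hausdorff_space T.

Section Construction.
Variables (O : nat -> set T) (W : set T).
Hypotheses (oO : forall k, open (O k)) (dO : forall k, dense (O k)).
Hypotheses (oW : open W) (W0 : W !=set0) (WO : W `&` \bigcap_k O k = set0).

(** W has no isolated points, since an isolated point would belong to all the
    dense sets O k; so finitely many points can be avoided. *)
Lemma generic_open (S : set T) (h : seq T) (n : nat) :
  open S -> S !=set0 -> S `<=` W ->
  exists S', [/\ open S', S' !=set0, S' `<=` S,
    forall t, t \in h -> ~ S' t & forall k, (k <= n)%N -> S' `<=` O k].
Proof.
elim: h S => [|t h IH] S oS S0 SW.
  elim: n => [|n [S' [oS' S'0 S'S _ S'O]]].
    exists (S `&` O 0%N); split => //; first exact: openI.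
    - exact: dO.
    - by move=> k; rewrite leqn0 => /eqP->.
  exists (S' `&` O n.+1); split => //; first exact: openI.
  - exact: dO.
  - by move=> y [/S'S].
  - by move=> k; rewrite leq_eqVlt ltnS => /orP[/eqP->|/S'O S'k] y [] // /S'k.
have oSt : open (S `\` [set t]).
  rewrite setDE; apply: openI => //; apply: closed_openC.
  exact: (accessible_closed_set1 (hausdorff_accessible hT)).
have [||S' [oS' S'0 S'S S'h S'O]] := IH (S `\` [set t]) oSt.
- apply: contrapT => /set0P/negP; rewrite negbK => /eqP St.
  have {}St : S = [set t].
    have St' : S `<=` [set t].
      by move=> y Sy; apply: contrapT => yt; rewrite -[False]/(set0 y) -St.
    apply/seteqP; split => // y ->.
    by have [y' /[dup] Sy' /St' <-] := S0.
  suff : (W `&` \bigcap_k O k) t by rewrite WO.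
  split; first by apply: SW; rewrite St.
  by move=> k _; have [y []] := @dO k S S0 oS; rewrite St => ->.
- by move=> y [/SW].
exists S'; split => //.
- by move=> y Sy; have [] := S'S y Sy.
- move=> s; rewrite inE => /orP[/eqP-> Sy|/S'h//].
  by have [_] := S'S t Sy; apply.
Qed.

(** A term is a point with a radius.  The new point is close to its parent, and
    its ball lies in the parent's ball.  The ball of twice the radius lies in
    the sets O k treated so far, so that limits of points of the ball still
    belong to them. *)
Definition extends (z0 : T * R) (h : seq (T * R)) (z : T * R) :=
  let n := size h in let p := nth z0 h (logn 2 n) in
  [/\ (0 < n)%N -> [/\ ball p.1 (p.2 / 2) z.1, ball p.1 n.+1%:R^-1 z.1
        & z.2 <= p.2 / 2],
      z.2 <= n.+1%:R^-1, z.1 \notin [seq w.1 | w <- h]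
    & forall k, (k <= n)%N -> ball z.1 (z.2 * 2) `<=` O k].

Definition centred_in_W (z : T * R) := 0 < z.2 /\ ball z.1 (z.2 * 2) `<=` W.

Lemma extends_exists z0 h : (forall w, w \in h -> centred_in_W w) ->
  exists z, centred_in_W z /\ extends z0 h z.
Proof.
move=> gh; set n := size h; set p := nth z0 h (logn 2 n).
have gp : (0 < n)%N -> centred_in_W p.
  by move=> n0; apply/gh/mem_nth; rewrite ltn_logl.
have n1 : 0 < n.+1%:R^-1 :> R by rewrite invr_gt0.
pose S := if (0 < n)%N then W `&` ((ball p.1 (p.2 / 2))° `&`
  (ball p.1 n.+1%:R^-1)°) else W.
have [||| S' [oS' [y S'y] S'S S'h S'O]] :=
  @generic_open S [seq w.1 | w <- h] n.
- rewrite /S; case: ifP => // _; apply: openI => //.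
  by apply: openI; apply: open_interior.
- rewrite /S; case: ifP => // /gp[p0 pW]; exists p.1; split.
    by apply: pW; apply: ballxx; rewrite mulr_gt0.
  by split; apply: nbhsx_ballx => //; rewrite divr_gt0.
- by rewrite /S; case: ifP => [_ y []|_ y].
have S'W : S' `<=` W.
  by move=> z /S'S; rewrite /S; case: ifP => [_ []|_].
have /nbhs_ballP[e /= e0 eS'] := open_nbhs_nbhs (conj oS' S'y).
pose r0 := Num.min (e / 2) n.+1%:R^-1.
have r00 : 0 < r0 by rewrite lt_min n1 divr_gt0.
pose r := if (0 < n)%N then Num.min r0 (p.2 / 2) else r0.
have r_gt0 : 0 < r.
  by rewrite /r; case: ifP => // /gp[p0 _]; rewrite lt_min r00 divr_gt0.
have rr0 : r <= r0 by rewrite /r; case: ifP => //; rewrite ge_min lexx.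
have ryS' : ball y (r * 2) `<=` S'.
  apply: subset_trans eS'; apply: le_ball.
  by rewrite -ler_pdivlMr//; apply: le_trans rr0 _; rewrite ge_min lexx.
exists (y, r); split.
  by split => //; apply: subset_trans S'W.
split => /=.
- move=> n0; move: (S'S _ S'y); rewrite /S n0 => -[_ [yp yn]].
  split; [exact: interior_subset yp|exact: interior_subset yn|].
  by rewrite /r n0 ge_min lexx orbT.
- by apply: le_trans rr0 _; rewrite ge_min lexx orbT.
- by apply/negP => /S'h.
- by move=> k kn; apply: subset_trans ryS' _; apply: S'O.
Qed.

Lemma tree_of_balls : exists x : nat -> T, exists r : nat -> R,
  [/\ forall n, 0 < r n /\ r n <= n.+1%:R^-1,
      forall n, (0 < n)%N -> [/\ ball (x (logn 2 n)) (r (logn 2 n) / 2) (x n),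
        ball (x (logn 2 n)) n.+1%:R^-1 (x n) & r n <= r (logn 2 n) / 2],
      injective x, ball (x 0%N) (r 0%N * 2) `<=` W &
      forall n k, (k <= n)%N -> ball (x n) (r n * 2) `<=` O k].
Proof.
have [t _] := W0.
have [f fP] := history_choice (@extends_exists (t, 0)).
pose x n := (f n).1; pose r n := (f n).2.
have fresh n i : (i < n)%N -> x n != x i.
  move=> ni; have [_ [_ _ nin _]] := fP n; apply: contra nin => /eqP xni.
  rewrite -/(x n) xni; apply: map_f; apply/mapP; exists i => //.
  by rewrite mem_iota.
exists x, r; split.
- by move=> n; have [[r0 _] [_ rn _ _]] := fP n; rewrite size_mkseq in rn.
- move=> n n0; have [_ [H _ _ _]] := fP n; move: H.
  by rewrite size_mkseq nth_mkseq ?ltn_logl// => /(_ n0).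
- move=> i j xij; case: (ltngtP i j) => // ij.
    by have := fresh _ _ ij; rewrite xij eqxx.
  by have := fresh _ _ ij; rewrite xij eqxx.
- by have [[_ ?] _] := fP 0%N.
- by move=> n k kn; have [_ [_ _ _]] := fP n; rewrite size_mkseq; apply.
Qed.

End Construction.

(** The range is closed: a point y of W fails to be in some O m, hence is away
    from the ball of every term after m.  A term n > m lies in the ball of an
    ancestor a > m whose parent is at most m; if a is large, the term is close
    to one of x 0, ..., x m, and only finitely many a remain. *)
Theorem crowded_closed_sequence : ~ Baire_space T ->
  exists x : nat -> T, [/\ injective x,
    forall p b e, 0 < e ->
      exists n, [/\ odd (logn 3 n) = b, n <> p & ball (x p) e (x n)] &
    forall y, ~ range x y -> exists2 d, 0 < d & forall n, ~ ball y d (x n)].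
Proof.
move=> nB.
have [O [oO [W [oW W0 WO]]]] : exists O : nat -> set T,
    (forall k, open (O k) /\ dense (O k)) /\
    exists W, [/\ open W, W !=set0 & W `&` \bigcap_k O k = set0].
  apply: contrapT => H; apply: nB => O oO W W0 oW.
  apply/set0P/negP => /eqP WO; apply: H.
  by exists O; split => //; exists W.
have [x [r [r0 par xinj xW xO]]] :=
  tree_of_balls (fun k => (oO k).1) (fun k => (oO k).2) oW W0 WO.
have anc m n : (m < n)%N -> exists a, [/\ (m < a)%N, (logn 2 a <= m)%N &
    ball (x n) (r n) `<=` ball (x a) (r a)].
  have [k] := ubnP n; elim: k n => // k IH n nk mn.
  have n0 : (0 < n)%N by apply: leq_ltn_trans mn.
  have pn : (logn 2 n < n)%N by rewrite ltn_logl.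
  have [pm|mp] := leqP (logn 2 n) m; first by exists n; split.
  have [|a [ma am sub]] := IH _ _ mp; first exact: leq_trans pn nk.
  exists a; split => //; apply: subset_trans sub => y yn.
  have [xp _ rp] := par n n0.
  exact: ball_split xp (le_ball rp yn).
exists x; split => //.
- move=> p b e e0; have [M MP] := invS_lt e0.
  have [n [Mn np nb]] := infinitely_many_codes p M b.
  have n0 : (0 < n)%N by apply: leq_ltn_trans Mn.
  exists n; split => //.
    by move=> E; move: (ltn_logl 2 n0); rewrite np E ltnn.
  have [_ + _] := par n n0; rewrite np.
  by apply: le_ball; apply/ltW/MP/ltnW.
move=> y xy.
have [Wy|nWy] := pselect (W y); last first.
  exists (r 0%N) => [|n yn]; first exact: (r0 0%N).1.
  apply/nWy/xW; rewrite mulr_natr mulr2n.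
  have x0n : ball (x 0%N) (r 0%N) (x n).
    case: (posnP n) => [->|n0]; first by apply: ballxx; exact: (r0 0%N).1.
    have [a [a0 + sub]] := anc _ _ n0; rewrite leqn0 => /eqP pa.
    have [xa _ ra] := par a a0; rewrite pa in xa ra.
    apply: ball_split xa (le_ball ra _).
    by apply: sub; apply: ballxx; exact: (r0 n).1.
  exact: ball_triangle x0n (ball_sym yn).
have [m Omy] : exists m, ~ O m y.
  apply: contrapT => /forallNP Oy; rewrite -[False]/(set0 y) -WO.
  by split => // k _; apply: contrapT; exact: Oy.
have sep i : exists2 d, 0 < d & ~ ball y d (x i).
  by apply: ball_avoiding_point => // xiy; apply: xy; exists i.
have [u u0 uP] : exists2 u : nat -> R, (forall i, 0 < u i) &
    forall i, ~ ball y (u i) (x i).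
  have /choice[u uP] : forall i, exists d, 0 < d /\ ~ ball y d (x i).
    by move=> i; have [d] := sep i; exists d.
  by exists u => i; case: (uP i).
have [d d0 dP] := @finite_lower_bound R u m.+1 (fun i _ => u0 i).
have d40 : 0 < d / 4 by rewrite divr_gt0.
have [M MP] := invS_lt d40.
have [d' d'0 d'P] := @finite_lower_bound R r M (fun i _ => (r0 i).1).
exists (Num.min (d / 4) d') => [|n]; first by rewrite lt_min d40.
move=> yn.
have yn1 : ball y (d / 4) (x n) by apply: le_ball yn; rewrite ge_min lexx.
have yn2 : ball y d' (x n) by apply: le_ball yn; rewrite ge_min lexx orbT.
have far i : (i <= m)%N -> ~ ball y d (x i).
  by move=> im yi; apply: (uP i); apply: le_ball yi; apply: dP.
have [nm|mn] := leqP n m.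
  apply: (far n nm); apply: le_ball yn1.
  by rewrite ler_pdivrMr// ler_peMr ?ler1n// ltW.
have [a [ma am sub]] := anc _ _ mn.
have xan : ball (x a) (r a) (x n) by apply: sub; apply: ballxx; exact: (r0 n).1.
have [aM|Ma] := ltnP a M.
  apply: Omy; apply: (xO a m (ltnW ma)).
  rewrite mulr_natr mulr2n; apply: ball_triangle xan (ball_sym _).
  by apply: le_ball yn2; apply: d'P.
have [_ xa _] := par a (leq_ltn_trans (leq0n _) ma).
have a4 : a.+1%:R^-1 <= d / 4 by apply/ltW/MP.
apply: (far _ am).
have -> : d = d / 4 + d / 4 + d / 4 + d / 4 by lra.
apply: ball_triangle (ballxx _ d40).
apply: ball_triangle (ball_sym (le_ball a4 xa)).
apply: ball_triangle yn1 (ball_sym (le_ball _ xan)).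
exact: le_trans (r0 a).2 a4.
Qed.

End NonBaire.

Lemma set_type_hausdorff (T : topologicalType) (A : set T) :
  hausdorff_space T -> hausdorff_space (set_type A).
Proof.
move=> hT a b ab; apply/val_inj/hT => U V Ua Vb.
have [|| c [Uc Vc]] := ab (set_val @^-1` U) (set_val @^-1` V).
- exact: (@initial_continuous A T set_val a).
- exact: (@initial_continuous A T set_val b).
by exists (set_val c).
Qed.

Lemma not_hereditarily_Baire_sequence (R : realType) (E : set (R * R)) :
  ~ hereditarily_Baire (@set_type (R * R) E) ->
  exists x : nat -> R * R, [/\ injective x, forall n, E (x n),
    forall p b e, 0 < e ->
      exists n, [/\ odd (logn 3 n) = b, n <> p & ball (x p) e (x n)] &
    forall y, E y -> ~ range x y ->
      exists2 d, 0 < d & forall n, ~ ball y d (x n)].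
Proof.
move=> /existsNP[A /not_implyP[cA nB]].
have hA : hausdorff_space (set_type A).
  by apply/set_type_hausdorff/set_type_hausdorff; exact: norm_hausdorff.
have [x [xinj xacc xcl]] := crowded_closed_sequence (R := R) hA nB.
exists (fun n => set_val (set_val (x n))); split.
- by move=> i j /val_inj/val_inj/xinj.
- by move=> n; apply: set_valP.
- exact: xacc.
move=> y Ey yx; pose y' : E := SigSub (mem_set Ey).
have [Ay|nAy] := pselect (A y').
  have [|d d0 dP] := xcl (SigSub (mem_set Ay)); last by exists d.
  by move=> [i _ xi]; apply: yx; exists i => //; rewrite xi.
have /nbhs_ballP[d /= d0 dP] : nbhs y' (~` A).
  by apply: open_nbhs_nbhs; split => //; apply: closed_openC.
exists d => // n yn; apply: (dP (set_val (x n)) yn); exact: set_valP.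
Qed.

(** * Half-open boxes and the Sorgenfrey topology *)

Definition box (R : realType) (p : R * R) (e : R) : set (R * R) :=
  [set y | p.1 <= y.1 < p.1 + e /\ p.2 <= y.2 < p.2 + e].

Lemma nbhs_sorgenfrey (R : realType) (x : sorgenfrey R) (U : set (sorgenfrey R)) :
  nbhs x U <->
  exists2 d : R, 0 < d & forall y : R, (x : R) <= y < (x : R) + d -> U y.
Proof.
rewrite nbhsE /=; split.
  move=> [V [[D _ <-] [p Dp px]] VU]; move: (px) => /andP[p1x xp2].
  exists (p.2 - x : R) => [|y /andP[xy yp2]]; first by rewrite subr_gt0.
  apply: VU; exists p => //; apply/andP; split; first exact: le_trans p1x xy.
  by move: yp2; rewrite addrC subrK.
move=> [d d0 dU]; exists (sorgenfrey_base ((x : R), (x : R) + d)); last exact: dU.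
split; last by rewrite /sorgenfrey_base /= lexx ltrDl.
by exists [set ((x : R), (x : R) + d)] => //; rewrite bigcup_set1.
Qed.

Lemma nbhs_sorgenfrey_plane (R : realType) (p : sorgenfrey_plane R)
    (U : set (sorgenfrey_plane R)) :
  nbhs p U <-> exists2 d : R, 0 < d & box (p : R * R) d `<=` U.
Proof.
split.
  move=> [[V1 V2] /= [/nbhs_sorgenfrey[d1 d10 V1P] /nbhs_sorgenfrey[d2 d20 V2P]] VU].
  exists (Num.min d1 d2) => [|y [/andP[a b] /andP[c d]]]; first by rewrite lt_min d10.
  apply: VU; split; [apply: V1P|apply: V2P].
    by rewrite a (lt_le_trans b)// lerD2l ge_min lexx.
  by rewrite c (lt_le_trans d)// lerD2l ge_min lexx orbT.
move=> [d d0 dU].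
exists ([set y : R | p.1 <= y < p.1 + d], [set y : R | p.2 <= y < p.2 + d]).
  by split => /=; apply/nbhs_sorgenfrey; exists d.
by move=> y [] /= y1 y2; apply: dU.
Qed.

Lemma sorgenfrey_continuous (R : realType) (g : sorgenfrey_plane R -> R) :
  continuous g -> forall p e, 0 < e ->
  exists2 d, 0 < d & forall y, box p d y -> `|g p - g y| < e.
Proof.
move=> gc p e e0; have /cvgrPdist_lt/(_ e e0) := gc p.
by move=> /nbhs_sorgenfrey_plane.
Qed.

Lemma locally_constant_continuous (R : realType) (E : set (sorgenfrey_plane R))
    (f : E -> R) :
  (forall a : E, exists2 d, 0 < d &
    forall c : E, box (set_val a) d (set_val c) -> f c = f a) ->
  continuous f.
Proof.
move=> fP a; have [d d0 dP] := fP a.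
have : f @ a --> f a; last by [].
move=> U /nbhs_singleton Ufa; rewrite /nbhs /=.
have : nbhs a (set_val @^-1` (box (set_val a : R * R) d)).
  apply: (@initial_continuous E (sorgenfrey_plane R) set_val a).
  by apply/nbhs_sorgenfrey_plane; exists d.
by apply: (@filterS _ _ (@nbhs_filter E a)) => c /= /dP ->.
Qed.

Section Boxes.
Variable R : realType.
Implicit Types (p q y z : R * R) (d e r : R).

Lemma ballE p e q : ball p e q <->
  (p.1 - e < q.1 < p.1 + e /\ p.2 - e < q.2 < p.2 + e).
Proof.
have H (a b : R) : ball a e b <-> a - e < b < a + e.
  by rewrite -ball_normE /ball_ /= distrC ltr_distl.
by split => [[/= /H a /H b]//|[/H a /H b]]; split.
Qed.

Lemma box_center p e : 0 < e -> box p e p.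
Proof. by move=> e0; rewrite /box /= !lexx !ltrDl e0. Qed.

Lemma le_box p d e : d <= e -> box p d `<=` box p e.
Proof.
move=> de y [/andP[a y1] /andP[b y2]]; rewrite /box /= a b /=.
by split; [apply: lt_le_trans y1 _|apply: lt_le_trans y2 _]; rewrite lerD2l.
Qed.

Lemma box_ball p e : box p e `<=` ball p e.
Proof.
move=> y [y1 y2]; apply/ballE; split; move: y1 y2.
  by move=> /andP[? ?] _; apply/andP; split; lra.
by move=> _ /andP[? ?]; apply/andP; split; lra.
Qed.

Lemma box_clopen p r y : exists2 d, 0 < d &
  forall z, box y d z -> (box p r z <-> box p r y).
Proof.
have H (a b t : R) : exists2 d, 0 < d & forall s, t <= s < t + d ->
    (a <= s < b) = (a <= t < b).
  have [ta|at_] := ltP t a.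
    exists (a - t) => [|s /andP[ts sd]]; first by rewrite subr_gt0.
    by rewrite leNgt (_ : s < a) //; lra.
  have [tb|bt] := ltP t b.
    exists (b - t) => [|s /andP[ts sd]]; first by rewrite subr_gt0.
    by apply/andP; split; lra.
  exists 1 => // s /andP[ts _].
  by rewrite [s < b]ltNge (le_trans bt ts) /= andbF.
have [d1 d10 H1] := H p.1 (p.1 + r) y.1.
have [d2 d20 H2] := H p.2 (p.2 + r) y.2.
exists (Num.min d1 d2) => [|z yz]; first by rewrite lt_min d10.
have [z1 _] : box y d1 z by apply: le_box yz; rewrite ge_min lexx.
have [_ z2] : box y d2 z by apply: le_box yz; rewrite ge_min lexx orbT.
by rewrite /box /= H1 // H2.
Qed.

Lemma boxes_clopen (c : nat -> R * R) (r : nat -> R) M y : exists2 d, 0 < d &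
  forall z, box y d z ->
  forall n, (n < M)%N -> (box (c n) (r n) z <-> box (c n) (r n) y).
Proof.
have /choice[u uP] : forall n, exists d, 0 < d /\
    forall z, box y d z -> (box (c n) (r n) z <-> box (c n) (r n) y).
  by move=> n; have [d] := box_clopen (c n) (r n) y; exists d.
have [d d0 dP] := @finite_lower_bound R u M (fun n _ => (uP n).1).
exists d => // z yz n nM; apply: (uP n).2.
by apply: le_box yz; apply: dP.
Qed.

End Boxes.

(** * Extending colourings to the Sorgenfrey plane *)

Definition first_at (P : nat -> Prop) (n : nat) :=
  P n /\ forall j, (j < n)%N -> ~ P j.

Lemma first_at_exists (P : nat -> Prop) n : P n -> exists m, first_at P m.
Proof.
move=> Pn; have [k] := ubnP n; elim: k n Pn => // k IH n Pn nk.
have [[j [jn Pj]]|nj] := pselect (exists j, (j < n)%N /\ P j).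
  by apply: (IH j) => //; apply: leq_trans jn nk.
by exists n; split => // j jn Pj; apply: nj; exists j.
Qed.

Lemma first_at_unique (P : nat -> Prop) m n :
  first_at P m -> first_at P n -> m = n.
Proof.
by move=> [Pm mP] [Pn nP]; case: (ltngtP m n) => // [/nP|/mP].
Qed.

Lemma eq_first_at (P Q : nat -> Prop) n :
  (forall j, (j <= n)%N -> (P j <-> Q j)) -> first_at P n -> first_at Q n.
Proof.
move=> PQ [Pn nP]; split; first exact/PQ.
by move=> j jn /(PQ _ (ltnW jn)); exact: nP.
Qed.

(** Let c change its value just after each n with T n: along the infinite set T
    the colours alternate. *)
Lemma parity_split (T : nat -> bool) :
  (forall M, exists2 n, (M <= n)%N & T n) ->
  exists c : nat -> bool, forall b M, exists n, [/\ (M <= n)%N, T n & c n = b].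
Proof.
move=> Tinf; pose c := fix c n := if n is m.+1 then c m (+) T m else false.
have cS n : c n.+1 = c n (+) T n by [].
exists c => b M; apply: contrapT => H.
have {}H n : (M <= n)%N -> T n -> c n = ~~ b.
  move=> Mn Tn; case: (eqVneq (c n) b) => [cb|]; last by case: (c n); case: b {H}.
  by case: H; exists n.
have [n0 Mn0 Tn0] := Tinf M.
have [n n0n Tn] := Tinf n0.+1.
have cb k : c (n0.+1 + k)%N = b.
  elim: k => [|k IH].
    by rewrite addn0 cS H // Tn0 addbT negbK.
  rewrite addnS cS IH; case Tk: (T _); last by rewrite addbF.
  have Mk : (M <= n0.+1 + k)%N.
    by rewrite addSn; apply: leqW; apply: leq_trans Mn0 (leq_addr _ _).
  by have := H _ Mk Tk; rewrite IH; case: b {H IH}.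
by have := H n (leq_trans Mn0 (ltnW n0n)) Tn; rewrite -(subnKC n0n) cb; case: b {H cb}.
Qed.

Section SorgenfreyExtension.
Variables (R : realType) (E : set (R * R)) (x : nat -> R * R).
Hypothesis EC : @Cstar_embedded R (sorgenfrey_plane R) E.
Hypothesis Ex : forall n, E (x n).
Hypothesis xcl : forall y, E y -> ~ range x y ->
  exists2 d, 0 < d & forall n, ~ ball y d (x n).

(** Colour a point of E by the first monochromatic box box (x n) (r n) that
    contains it.  Boxes are clopen and their radii tend to 0, so a point of E
    off the Euclidean-closed set range x has a neighbourhood meeting only
    finitely many of them; hence the colouring is locally constant on E and
    C*-embeddedness applies. *)
Lemma extend_colouring (col : nat -> Prop) :
  (forall n, exists2 d, 0 < d & forall m, box (x n) d (x m) ->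
    (col m <-> col n)) ->
  exists g : R * R -> R,
    (forall p e, 0 < e ->
      exists2 d, 0 < d & forall y, box p d y -> `|g p - g y| < e) /\
    forall n, (col n -> g (x n) = 1) /\ (~ col n -> g (x n) = 0).
Proof.
move=> colP.
have /choice[r rP] : forall n, exists d, [/\ 0 < d, d <= n.+1%:R^-1 &
    forall m, box (x n) d (x m) -> (col m <-> col n)].
  move=> n; have [d d0 dP] := colP n; exists (Num.min d n.+1%:R^-1).
  rewrite lt_min d0 invr_gt0 ltr0n ge_min lexx orbT; split => // m xm.
  by apply: dP; apply: le_box xm; rewrite ge_min lexx.
pose Q (y : R * R) n := box (x n) (r n) y.
pose f (y : E) : R := `[< exists2 n, first_at (Q (set_val y)) n & col n >]%:R.
have fc : continuous (f : @set_type (sorgenfrey_plane R) E -> R).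
  apply: locally_constant_continuous => a.
  set y := (set_val a : R * R).
  have [[n yn]|noy] := pselect (exists n, first_at (Q y) n).
    have [d d0 dP] := boxes_clopen x r n.+1 y; exists d => // c /dP yc.
    have cn : first_at (Q (set_val c)) n.
      by apply: eq_first_at yn => j jn; split => /yc; apply.
    congr (_%:R); apply/congr1/asbool_equiv_eq.
    by split => -[m mP colm]; exists n => //;
      [rewrite -(first_at_unique mP cn)|rewrite -(first_at_unique mP yn)].
  have yQ n : ~ Q y n by move=> /first_at_exists.
  have Ey : E y by apply: set_valP.
  have [|d d0 dP] := xcl Ey.
    move=> [n _ xny]; apply: (yQ n); rewrite /Q xny.
    by apply: box_center; case: (rP n).
  have d20 : 0 < d / 2 by rewrite divr_gt0.
  have [M MP] := invS_lt d20.
  have [d' d'0 d'P] := boxes_clopen x r M y.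
  exists (Num.min d' (d / 2)) => [|c yc]; first by rewrite lt_min d'0.
  have cQ n : ~ Q (set_val c) n.
    move=> cn; have [nM|Mn] := ltnP n M.
      apply: (yQ n); apply/(d'P (set_val c) _ n nM) => //.
      by apply: le_box yc; rewrite ge_min lexx.
    apply: (dP n); have [_ rn _] := rP n.
    apply: (@ball_split _ _ (set_val c : R * R)).
      by apply: box_ball; apply: le_box yc; rewrite ge_min lexx orbT.
    apply: ball_sym; apply: le_ball (box_ball cn).
    exact: le_trans rn (ltW (MP _ Mn)).
  congr (_%:R); apply/congr1/asbool_equiv_eq.
  by split => -[m [mP _]]; [case: (cQ m)|case: (yQ m)].
have fb : bounded_fun (f : @set_type (sorgenfrey_plane R) E -> R).
  exists 1; split; first exact: num_real.
  move=> M M1 y _ /=; rewrite /f; case: `[< _ >]; rewrite ?normr1 ?normr0 ltW//.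
  exact: lt_trans M1.
have [g [gc gf]] := EC fc fb.
exists g; split; first exact: sorgenfrey_continuous.
move=> n; have xE : g (x n) = f (SigSub (mem_set (Ex n))) by rewrite -gf.
have xn : Q (x n) n by apply: box_center; case: (rP n).
have [m xm] := first_at_exists xn.
have [_ _ rm] := rP m; have := rm n xm.1 => cmn.
rewrite xE /f; split => cn.
  by rewrite asboolT //; exists m => //; apply/cmn.
rewrite asboolF // => -[m' xm' cm'].
by apply: cn; apply/cmn; rewrite (first_at_unique xm xm').
Qed.

(** If the sequence accumulated at p from the upper right, infinitely many rings
    between boxes with corner p would contain terms; alternating colours on
    these rings give a colouring whose extension oscillates at p. *)
Lemma sorgenfrey_closed p : ~ range x p ->
  exists2 d, 0 < d & forall n, ~ box p d (x n).
Proof.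
move=> xp; have [Ep|nEp] := pselect (E p).
  by have [d d0 dP] := xcl Ep xp; exists d => // n /box_ball; exact: dP.
apply: contrapT => /forall2NP H.
have {}H d : 0 < d -> exists n, box p d (x n).
  move=> d0; have [//|/existsNP[n /contrapT nP]] := H d; by exists n.
(* the concentric boxes B j shrink to p and cut the rings on which the
   colours alternate *)
pose B j := box p (j.+1%:R^-1 : R).
pose ring i := first_at (fun j => ~ B j (x i)).
have ring_exists i : exists n, ring i n.
  have [d d0 dP] : exists2 d, 0 < d & ~ box p d (x i).
    have [||d d0 dP] := @ball_avoiding_point _ _ p (x i).
    - exact: norm_hausdorff.
    - by move=> xip; apply: xp; exists i.
    by exists d => // /box_ball.
  have [M MP] := invS_lt d0; apply: (@first_at_exists _ M) => BM.
  by apply: dP; apply: le_box BM; apply/ltW/MP.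
pose T n := `[< exists i, ring i n >].
have Tinf M : exists2 n, (M <= n)%N & T n.
  have [i Bi] : exists i, B M (x i) by apply: H; rewrite invr_gt0.
  have [n inn] := ring_exists i; exists n; last by apply/asboolP; exists i.
  rewrite leqNgt; apply/negP => nM; apply: inn.1; apply: le_box Bi.
  by rewrite lef_pV2 ?posrE // ler_nat ltnW.
have [c cP] := parity_split Tinf.
have [|g [gc gP]] := @extend_colouring (fun i => exists2 n, ring i n & c n).
  move=> i; have [n inn] := ring_exists i.
  have [d d0 dP] := boxes_clopen (fun=> p) (fun j => j.+1%:R^-1) n.+1 (x i).
  exists d => // m /dP im.
  have mn : ring m n.
    apply: eq_first_at inn => j jn; have [mi im'] := im j jn.
    by split => nB Bj; apply: nB; [exact: mi|exact: im'].
  split => -[k kP ck]; exists n => //.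
    by rewrite -(first_at_unique kP mn).
  by rewrite -(first_at_unique kP inn).
have h0 : 0 < 2^-1 :> R by rewrite invr_gt0.
have [d d0 dP] := gc p _ h0.
have [M MP] := invS_lt d0.
have near_p n i : (M < n)%N -> ring i n -> `|g p - g (x i)| < 2^-1.
  move=> Mn [_ /(_ _ Mn)/contrapT Bi]; apply: dP.
  by apply: le_box Bi; apply/ltW/MP.
have [n1 [Mn1 /asboolP[i1 i1n] c1]] := cP true M.+1.
have [n0 [Mn0 /asboolP[i0 i0n] c0]] := cP false M.+1.
have := near_p _ _ Mn1 i1n; rewrite (gP i1).1; last by exists n1.
have := near_p _ _ Mn0 i0n; rewrite (gP i0).2; last first.
  by move=> [k kP]; rewrite -(first_at_unique i0n kP) c0.
by rewrite !ltr_distl => /andP[? ?] /andP[? ?]; lra.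
Qed.
End SorgenfreyExtension.

(** * Category arguments on the closure of a set *)

(** In each coordinate the supremum of the lower ends of the intervals lies
    below all their upper ends. *)
Lemma nested_balls_limit (R : realType) (y : nat -> R * R) (e : nat -> R) :
  (forall m n, (m <= n)%N -> ball (y m) (e m) (y n)) ->
  exists l, forall n d, e n < d -> ball (y n) d l.
Proof.
have H (u : nat -> R) :
    (forall m n, (m <= n)%N -> u m - e m <= u n <= u m + e m) ->
    exists l, forall n, u n - e n <= l <= u n + e n.
  move=> ue; pose S := range (fun n => u n - e n).
  have Sub n : ubound S (u n + e n).
    move=> _ [m _ <-].
    have /andP[h1 _] := ue _ _ (leq_maxl m n).
    have /andP[_ h2] := ue _ _ (leq_maxr m n).
    exact: le_trans h1 h2.
  exists (sup S) => n; apply/andP; split.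
    by apply: ub_le_sup; [exists (u n + e n)|exists n].
  by apply: ge_sup; first by exists (u 0%N - e 0%N); exists 0%N.
move=> ye.
have [|l1 l1P] := H (fun n => (y n).1).
  by move=> m n /ye/ballE[/andP[? ?] _]; apply/andP; split; lra.
have [|l2 l2P] := H (fun n => (y n).2).
  by move=> m n /ye/ballE[_ /andP[? ?]]; apply/andP; split; lra.
exists (l1, l2) => n d ed; apply/ballE => /=.
have /andP[? ?] := l1P n; have /andP[? ?] := l2P n.
by split; apply/andP; split; lra.
Qed.

(** The Baire category theorem for the closed set closure F, with centres taken
    in F: otherwise balls centred in F could be shrunk to avoid P 0, P 1, ...
    in turn, and their common point would lie in closure F but in no P n. *)
Lemma closure_Baire (R : realType) (F : set (R * R)) (P : nat -> set (R * R)) :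
  F !=set0 -> (forall p, closure F p -> exists n, P n p) ->
  exists n y e, [/\ F y, 0 < e & forall z, F z -> ball y e z ->
    forall d, 0 < d -> exists2 w, P n w & ball z d w].
Proof.
move=> [p0 Fp0] cover; apply: contrapT => H.
have step n y e : F y -> 0 < e -> exists z d, [/\ F z, ball y e z, 0 < d &
    forall w, ball z d w -> ~ P n w].
  move=> Fy e0; apply: contrapT => nex; apply: H; exists n, y, e; split => //.
  move=> z Fz yz d d0; apply: contrapT => nw; apply: nex; exists z, d; split => //.
  by move=> w zw Pw; apply: nw; exists w.
pose good (z : (R * R) * R) := F z.1 /\ 0 < z.2.
pose shrinks h (z : (R * R) * R) := let p := last (p0, 1) h in
  [/\ ball p.1 (p.2 / 2) z.1, z.2 <= p.2 / 2, z.2 <= (size h).+1%:R^-1 &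
      forall w, ball z.1 (z.2 * 2) w -> ~ P (size h) w].
have [|f fP] := @history_choice _ good shrinks.
  move=> h gh; set p := last (p0, 1) h.
  have [Fp p2] : good p.
    rewrite /p; case: h gh {p} => [|w h] gh; first by split => //=.
    by apply: gh; rewrite /= mem_last.
  have p20 : 0 < p.2 / 2 by rewrite divr_gt0.
  have [z [d [Fz pz d0 dP]]] := step (size h) _ _ Fp p20.
  have d20 : 0 < d / 2 by rewrite divr_gt0.
  exists (z, Num.min (d / 2) (Num.min (p.2 / 2) (size h).+1%:R^-1)); split.
    by split => //=; rewrite !lt_min d20 p20 invr_gt0 ltr0n.
  split => //=; rewrite -/p.
  - by rewrite !ge_min lexx orbT.
  - by rewrite !ge_min lexx !orbT.
  - move=> w zw; apply: dP; apply: le_ball zw.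
    by rewrite -ler_pdivlMr // ge_min lexx.
pose y n := (f n).1; pose e n := (f n).2.
have e0 n : 0 < e n by case: (fP n) => -[].
have succ n : ball (y n) (e n / 2) (y n.+1) /\ e n.+1 <= e n / 2.
  by have [_ []] := fP n.+1; rewrite mkseqS last_rcons.
have nested m n : (m <= n)%N -> ball (y n) (e n) `<=` ball (y m) (e m).
  move=> /subnKC <-; elim: (n - m)%N => [|k IH]; first by rewrite addn0.
  rewrite addnS; apply: subset_trans IH => z zb.
  have [b1 b2] := succ (m + k)%N.
  exact: ball_split b1 (le_ball b2 zb).
have [|l lP] := @nested_balls_limit _ y e.
  by move=> m n /nested; apply; apply: ballxx.
have [n Pn] : exists n, P n l.
  apply: cover => U /nbhs_ballP[d /= d0 dU].
  have [M MP] := invS_lt d0; exists (y M); split; first by case: (fP M) => -[].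
  apply/dU/ball_sym/lP; apply: le_lt_trans (MP M (leqnn _)).
  by have [_ []] := fP M; rewrite size_mkseq.
have [_ [_ _ _]] := fP n; rewrite size_mkseq => /(_ l); apply => //.
by apply: lP; rewrite ltr_pMr// ltr1n.
Qed.

(** By category, the boxes on which g stays below 2/3 (coded by odd n), or those
    on which it stays above 1/3 (even n), have a uniform size at densely many
    corners.  A point of F of the colour that contradicts this bound has a box
    of its own, and boxes with nearby corners intersect, for instance in the
    coordinatewise maximum of the corners. *)
Lemma no_continuous_dense_splitting (R : realType) (g : R * R -> R)
    (F A B : set (R * R)) :
  (forall p e, 0 < e ->
    exists2 d, 0 < d & forall y, box p d y -> `|g p - g y| < e) ->
  F !=set0 ->
  (forall p d, F p -> 0 < d -> exists2 q, (F `&` A) q & ball p d q) ->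
  (forall p d, F p -> 0 < d -> exists2 q, (F `&` B) q & ball p d q) ->
  (forall p, A p -> g p = 1) -> (forall p, B p -> g p = 0) -> False.
Proof.
move=> gc F0 FA FB gA gB.
pose P n := [set p | forall y, box p (n.+1%:R^-1 : R) y ->
  if odd n then g y < 2 / 3 else 1 / 3 < g y].
have [|n [p [e [Fp e0 Pd]]]] := @closure_Baire R F P F0.
  move=> p _; have [|d d0 dP] := gc p (1 / 6); first by lra.
  have [M MP] := invS_lt d0; have [gp|gp] := ltP (g p) (1 / 2).
    exists (M.*2.+1) => y py; rewrite /= odd_double /=.
    have : box p d y.
      by apply: le_box py; apply/ltW/MP; rewrite -addnn leqW ?leq_addr.
    by move=> /dP; rewrite ltr_distl => /andP[? ?]; lra.
  exists (M.*2) => y py; rewrite odd_double /=.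
  have : box p d y.
    by apply: le_box py; apply/ltW/MP; rewrite -addnn leq_addr.
  by move=> /dP; rewrite ltr_distl => /andP[? ?]; lra.
have [q [Fq qC] pq] : exists2 q, (F `&` (if odd n then A else B)) q & ball p e q.
  by case: odd; [apply: FA|apply: FB].
have [|d d0 dP] := gc q (1 / 3); first by lra.
have n0 : 0 < n.+1%:R^-1 :> R by rewrite invr_gt0.
have [|w Pw qw] := Pd q Fq pq (Num.min d n.+1%:R^-1).
  by rewrite lt_min d0.
pose y := (Num.max q.1 w.1, Num.max q.2 w.2).
have /ballE[/andP[w1 w2] /andP[w3 w4]] : ball q d w.
  by apply: le_ball qw; rewrite ge_min lexx.
have /ballE[/andP[w5 w6] /andP[w7 w8]] : ball q n.+1%:R^-1 w.
  by apply: le_ball qw; rewrite ge_min lexx orbT.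
have qy : box q d y.
  by split; rewrite /= le_max lexx /= gt_max; apply/andP; split; lra.
have wy : box w n.+1%:R^-1 y.
  move: (n.+1%:R^-1 : R) n0 w5 w6 w7 w8 => r r0 w5 w6 w7 w8.
  by split; rewrite /= le_max lexx orbT /= gt_max; apply/andP; split; lra.
have := dP y qy; have := Pw y wy; rewrite ltr_distl.
case: odd qC => [/gA ->|/gB ->] /= gy /andP[? ?]; lra.
Qed.

(** * Sorgenfrey-closed crowded sequences are somewhere discrete *)

Section CountableSet.
Variables (R : realType) (x : nat -> R * R).
Let F := range x.
Hypothesis xacc : forall p e, 0 < e -> exists n, n <> p /\ ball (x p) e (x n).
Hypothesis xinj : injective x.
Hypothesis xclosed : forall p, ~ F p ->
  exists2 d, 0 < d & forall n, ~ box p d (x n).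

Definition empty_box (r : R) : set (R * R) :=
  [set z | closure F z /\ forall n, ~ box z r (x n)].

(** A point of closure F is a term of the sequence or the corner of an empty
    box, so category applies.  As F is crowded, discarding the single term
    x n from the n-th piece keeps it dense. *)
Lemma empty_boxes_dense : exists a r e, [/\ 0 < r, 0 < e &
  forall n, ball (x a) e (x n) -> forall d, 0 < d ->
    exists2 z, empty_box r z & ball (x n) d z].
Proof.
pose P n := [set p | closure F p /\
  (p = x n \/ forall m, ~ box p (n.+1%:R^-1 : R) (x m))].
have [||n [y [e [[a _ <-] e0 Pd]]]] := @closure_Baire R F P.
- by exists (x 0%N), 0%N.
- move=> p Fp; have [[n _ xn]|/xclosed[d d0 dP]] := pselect (F p).
    by exists n; split => //; left.
  have [M MP] := invS_lt d0; exists M; split => //; right => m pm.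
  by apply: (dP m); apply: le_box pm; apply/ltW/MP.
have e20 : 0 < e / 2 by rewrite divr_gt0.
exists a, n.+1%:R^-1, (e / 2); split => //.
move=> m am d d0; have d20 : 0 < d / 2 by rewrite divr_gt0.
(* the only point of F in P n is x n, so a nearby point of F is used instead *)
have [k [kn ak mk]] : exists k, [/\ k <> n, ball (x a) e (x k) & ball (x m) (d / 2) (x k)].
  have [mn|mn] := pselect (m = n); last first.
    exists m; split => //; last exact: ballxx.
    by apply: le_ball am; lra.
  have [|k [km mk]] := xacc m (e := Num.min (d / 2) (e / 2)).
    by rewrite lt_min d20.
  exists k; split; first by rewrite -mn.
    by apply: ball_split am (le_ball _ mk); rewrite ge_min lexx orbT.
  by apply: le_ball mk; rewrite ge_min lexx.
have [||d' d'0 d'P] := @ball_avoiding_point _ _ (x k) (x n).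
- exact: norm_hausdorff.
- by move=> /xinj nk; apply: kn.
have [||w [Fw wP] kw] := Pd (x k) _ ak (Num.min (d / 2) d').
- by exists k.
- by rewrite lt_min d20.
exists w; last by apply: ball_split mk (le_ball _ kw); rewrite ge_min lexx.
split => //; case: wP => // wn; case: d'P; rewrite -wn.
by apply: le_ball kw; rewrite ge_min lexx orbT.
Qed.

(** Near x a there are corners of empty boxes of size r arbitrarily close to each
    term, with r large compared with the size e of the region.  Such a corner
    is not below and to the left of a term, which rules out chains u << v and
    then three terms on a horizontal or vertical line.  So a small half-open
    box at a term meets the other terms of the region neither in its interior
    nor, when it is short enough, on its two edges. *)
Lemma locally_discrete : exists a e, 0 < e /\
  forall n, ball (x a) e (x n) -> exists2 d, 0 < d &
    forall m, ball (x a) e (x m) -> box (x n) d (x m) -> m = n.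
Proof.
have [a [r [e0 [r0 e00 dense_empty]]]] := empty_boxes_dense.
pose e := Num.min (e0 / 4) (r / 8).
have e_gt0 : 0 < e by rewrite lt_min; apply/andP; split; lra.
have e_e0 : e <= e0 / 4 by rewrite ge_min lexx.
have e_r : e <= r / 8 by rewrite ge_min lexx orbT.
clearbody e.
pose I n := ball (x a) e (x n); pose I2 n := ball (x a) (2 * e) (x n).
have empty_near n d : I2 n -> 0 < d ->
    exists2 z, empty_box r z & ball (x n) d z.
  by move=> n2; apply: dense_empty; apply: le_ball n2; lra.
(* an empty corner just below and to the left of u would see v *)
have no_chain u v : I2 u -> I2 v ->
    (x u).1 < (x v).1 -> (x u).2 < (x v).2 -> False.
  move=> u2 v2 h1 h2.
  have [|z [_ zP] uz] := empty_near u
      (Num.min (Num.min ((x v).1 - (x u).1) ((x v).2 - (x u).2)) (r / 4)) u2.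
    by rewrite !lt_min; repeat (apply/andP; split); lra.
  apply: (zP v); move: u2 v2 uz => /ballE[/andP[? ?] /andP[? ?]].
  move=> /ballE[/andP[? ?] /andP[? ?]] /ballE[].
  set d := Num.min _ _.
  have : d <= (x v).1 - (x u).1 by rewrite !ge_min lexx.
  have : d <= (x v).2 - (x u).2 by rewrite !ge_min lexx orbT.
  have : d <= r / 4 by rewrite !ge_min lexx !orbT.
  move=> ? ? ? /andP[? ?] /andP[? ?].
  by split; apply/andP; split; lra.
have not_below q v z : I q -> I v -> empty_box r z -> ball (x q) (e / 2) z ->
    z.1 <= (x v).1 -> z.2 <= (x v).2 -> False.
  move=> /ballE[/andP[? ?] /andP[? ?]] /ballE[/andP[? ?] /andP[? ?]] [_ zP].
  move=> /ballE[/andP[? ?] /andP[? ?]] ? ?; apply: (zP v).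
  by split; apply/andP; split; lra.
have not_above q p z : I q -> I p -> empty_box r z -> ball (x q) (e / 2) z ->
    (x p).1 < z.1 -> (x p).2 < z.2 -> False.
  move=> Iq Ip [Fz _] qz h1 h2.
  pose d := Num.min (Num.min (z.1 - (x p).1) (z.2 - (x p).2)) (e / 2).
  have d0 : 0 < d by rewrite !lt_min; repeat (apply/andP; split); lra.
  have d1 : d <= z.1 - (x p).1 by rewrite !ge_min lexx.
  have d2 : d <= z.2 - (x p).2 by rewrite !ge_min lexx orbT.
  have d3 : d <= e / 2 by rewrite !ge_min lexx !orbT.
  have [_ [[v _ <-] zv]] := Fz _ (nbhsx_ballx z d d0).
  clearbody d.
  move: Ip Iq qz zv => /ballE[/andP[? ?] /andP[? ?]] /ballE[/andP[? ?] /andP[? ?]].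
  move=> /ballE[/andP[? ?] /andP[? ?]] /ballE[/andP[? ?] /andP[? ?]].
  by apply: (no_chain p v); rewrite /I2; try apply/ballE; try split; try (apply/andP; split); lra.
(* an empty corner near the middle term q, and strictly to the right of p and
   to the left of s, is either below s or above p *)
have no_horizontal p q s : I p -> I q -> I s -> (x p).1 < (x q).1 < (x s).1 ->
    (x q).2 = (x p).2 -> (x s).2 = (x p).2 -> False.
  move=> Ip Iq Is /andP[pq qs] q2 s2.
  pose d := Num.min (Num.min ((x q).1 - (x p).1) ((x s).1 - (x q).1)) (e / 2).
  have d0 : 0 < d by rewrite !lt_min; repeat (apply/andP; split); lra.
  have d1 : d <= (x q).1 - (x p).1 by rewrite !ge_min lexx.
  have d2 : d <= (x s).1 - (x q).1 by rewrite !ge_min lexx orbT.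
  have d3 : d <= e / 2 by rewrite !ge_min lexx !orbT.
  have [||z ez qz] := empty_near q d; [|exact: d0|].
    by apply: le_ball Iq; lra.
  have qz' := le_ball d3 qz; move/ballE: qz => [/andP[? ?] _].
  have [zs|zs] := leP z.2 (x s).2.
    by apply: (not_below q s z) => //; lra.
  by apply: (not_above q p z) => //; lra.
have no_vertical p q s : I p -> I q -> I s -> (x p).2 < (x q).2 < (x s).2 ->
    (x q).1 = (x p).1 -> (x s).1 = (x p).1 -> False.
  move=> Ip Iq Is /andP[pq qs] q2 s2.
  pose d := Num.min (Num.min ((x q).2 - (x p).2) ((x s).2 - (x q).2)) (e / 2).
  have d0 : 0 < d by rewrite !lt_min; repeat (apply/andP; split); lra.
  have d1 : d <= (x q).2 - (x p).2 by rewrite !ge_min lexx.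
  have d2 : d <= (x s).2 - (x q).2 by rewrite !ge_min lexx orbT.
  have d3 : d <= e / 2 by rewrite !ge_min lexx !orbT.
  have [||z ez qz] := empty_near q d; [|exact: d0|].
    by apply: le_ball Iq; lra.
  have qz' := le_ball d3 qz; move/ballE: qz => [_ /andP[? ?]].
  have [zs|zs] := leP z.1 (x s).1.
    by apply: (not_below q s z) => //; lra.
  by apply: (not_above q p z) => //; lra.
exists a, e; split => // p Ip.
have I2I n : I n -> I2 n by move=> In; apply: le_ball In; lra.
have [dh dh0 dhP] : exists2 d, 0 < d & forall q, I q ->
    (x p).1 < (x q).1 < (x p).1 + d -> (x q).2 = (x p).2 -> False.
  (* the box stops short of the one term s that may lie on its lower edge *)
  have [[s [Is ps s2]]|nos] := pselect (exists s,
      [/\ I s, (x p).1 < (x s).1 & (x s).2 = (x p).2]).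
    exists ((x s).1 - (x p).1) => [|q Iq /andP[pq qs] q2]; first by lra.
    by apply: (no_horizontal p q s) => //; apply/andP; split; lra.
  by exists 1 => // q Iq /andP[pq _] q2; apply: nos; exists q.
have [dv dv0 dvP] : exists2 d, 0 < d & forall q, I q ->
    (x p).2 < (x q).2 < (x p).2 + d -> (x q).1 = (x p).1 -> False.
  have [[s [Is ps s2]]|nos] := pselect (exists s,
      [/\ I s, (x p).2 < (x s).2 & (x s).1 = (x p).1]).
    exists ((x s).2 - (x p).2) => [|q Iq /andP[pq qs] q2]; first by lra.
    by apply: (no_vertical p q s) => //; apply/andP; split; lra.
  by exists 1 => // q Iq /andP[pq _] q2; apply: nos; exists q.
exists (Num.min dh dv) => [|q Iq pq]; first by rewrite lt_min dh0.
have [/andP[q1 q1d] _] : box (x p) dh (x q).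
  by apply: le_box pq; rewrite ge_min lexx.
have [_ /andP[q2 q2d]] : box (x p) dv (x q).
  by apply: le_box pq; rewrite ge_min lexx orbT.
move: q1 q2; rewrite !le_eqVlt => /orP[/eqP e1|l1] /orP[/eqP e2|l2].
- by apply: xinj; rewrite [LHS]surjective_pairing [RHS]surjective_pairing e1 e2.
- by case: (dvP q Iq); rewrite ?l2.
- by case: (dhP q Iq); rewrite ?l1.
- by case: (no_chain p q (I2I _ Ip) (I2I _ Iq) l1 l2).
Qed.

End CountableSet.

Theorem theorem3p5 (R : realType) (E : set (R * R)) :
  @Cstar_embedded R (sorgenfrey_plane R) E ->
  hereditarily_Baire (@set_type (R * R) E).
Proof.
move=> EC; apply: contrapT => /not_hereditarily_Baire_sequence.
move=> [x [xinj Ex xacc xcl]].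
have xacc1 p e : 0 < e -> exists n, n <> p /\ ball (x p) e (x n).
  by move=> /(xacc p true)[n [_ ? ?]]; exists n.
have [a [e [e0 isolated]]] :=
  locally_discrete xacc1 xinj (sorgenfrey_closed EC Ex xcl).
(* the half-open square box c e is clopen, so that the colouring, which is
   constant outside it, is locally constant at the terms outside it *)
pose c : R * R := ((x a).1 - e / 2, (x a).2 - e / 2).
have box_e y : box c e y -> ball (x a) e y.
  move=> [/= /andP[? ?] /andP[? ?]]; apply/ballE.
  by split; apply/andP; split; lra.
have e_box y : ball (x a) (e / 2) y -> box c e y.
  move=> /ballE[/andP[? ?] /andP[? ?]].
  by split => /=; apply/andP; split; lra.
pose col n := box c e (x n) /\ odd (logn 3 n).
have [|g [gc gcol]] := @extend_colouring R E x EC Ex xcl col.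
  move=> n; have [d d0 dP] := box_clopen c e (x n).
  have [cn|ncn] := pselect (box c e (x n)); last first.
    by exists d => // m /dP cm; split => -[] // /cm.
  have [d' d'0 d'P] := isolated n (box_e _ cn).
  exists (Num.min d d') => [|m nm]; first by rewrite lt_min d0.
  have cm : box c e (x m).
    by apply/(dP (x m)) => //; apply: le_box nm; rewrite ge_min lexx.
  rewrite (d'P m (box_e _ cm)) //.
  by apply: le_box nm; rewrite ge_min lexx orbT.
pose U := (ball (x a) (e / 2))°.
have Ucol n : U (x n) -> box c e (x n).
  by move=> /interior_subset/e_box.
pose C (b : bool) := [set p | exists2 n, p = x n & U p /\ odd (logn 3 n) = b].
have dense_colour b p d : (U `&` range x) p -> 0 < d ->
    exists2 q, (U `&` range x `&` C b) q & ball p d q.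
  move=> [Up [n _ xn]] d0; rewrite -xn in Up *.
  have /nbhs_ballP[d' /= d'0 d'P] : nbhs (x n) U.
    by apply: open_nbhs_nbhs; split => //; apply: open_interior.
  have [|m [mb _ nm]] := xacc n b (Num.min d d').
    by rewrite lt_min d0.
  have Um : U (x m) by apply: d'P; apply: le_ball nm; rewrite ge_min lexx orbT.
  exists (x m); last by apply: le_ball nm; rewrite ge_min lexx.
  by split; [split => //; exists m|exists m].
apply: (@no_continuous_dense_splitting R g (U `&` range x) (C true) (C false) gc).
- exists (x a); split; last by exists a.
  by apply: nbhsx_ballx; rewrite divr_gt0.
- by move=> p d; apply: dense_colour.
- by move=> p d; apply: dense_colour.
- by move=> _ [n -> [Un bn]]; apply: (gcol n).1; split => //; apply: Ucol.
- by move=> _ [n -> [Un bn]]; apply: (gcol n).2 => -[_]; rewrite bn.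
Qed.
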